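(* Let $M=\{a,b\}\cup\{u_i,v_i: i\in\mathbb{N}\}$ (all listed points being distinct) be the metric space in which the distances between different points are as follows: for any $i,j\in\mathbb{N}$ with $i\neq j$, $$d(a,b)=d(a,v_i)=d(b,u_i)=d(u_i,u_j)=d(v_i,v_j)=d(u_i,v_j)=2,$$ and for any $i\in\mathbb{N}$, $$d(a,u_i)=d(b,v_i)=d(u_i,v_i)=1.$$ Then for every finite subset $N$ of $M$ and every $\varepsilon>0$ there exist $u,v\in M$, $u\ne v$, such that for all $x,y,z,w\in N$ $$(1-\varepsilon)\bigl(2d(u,v)+d(x,y)+d(z,w)\bigr)\le d(x,u)+d(y,u)+d(z,v)+d(w,v),$$ but $M$ does not have the long trapezoid property.
   Context: A metric space $M$ with metric $d$ has the long trapezoid property if, for every finite subset $N$ of $M$ and every $\varepsilon>0$, there exist $u,v\in M$, $u\neq v$, such that for all $x,y\in N$ $$(1-\varepsilon)\bigl(d(x,y)+d(u,v)\bigr)\le d(x,u)+d(y,v).$$ *)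

(* Defs.v *)
From HB Require Import structures.
From mathcomp Require Import all_boot all_order all_algebra.
From mathcomp Require Import classical_sets cardinality reals topology.
From mathcomp Require Import lra.

Set Implicit Arguments.
Unset Strict Implicit.
Unset Printing Implicit Defensive.

Import Order.TTheory GRing.Theory Num.Theory.
Local Open Scope classical_set_scope.
Local Open Scope ring_scope.

Definition long_trapezoid_property (R : realType) (M : metricType R) : Prop :=
  forall (N : set M) (eps : R), finite_set N -> 0 < eps ->
  exists u v : M, u <> v /\
    forall x y : M, N x -> N y ->
      (1 - eps) * (mdist x y + mdist u v) <= mdist x u + mdist y v.

Inductive vertex : Type := pt_a | pt_b | pt_u of nat | pt_v of nat.

Definition vertex_code (p : vertex) : bool + (nat + nat) :=
  match p with
  | pt_a => inl true
  | pt_b => inl false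
  | pt_u i => inr (inl i)
  | pt_v i => inr (inr i)
  end.

Definition vertex_decode (c : bool + (nat + nat)) : vertex :=
  match c with
  | inl true => pt_a
  | inl false => pt_b
  | inr (inl i) => pt_u i
  | inr (inr i) => pt_v i
  end.

Lemma vertex_codeK : cancel vertex_code vertex_decode.
Proof. by case. Qed.

HB.instance Definition _ := Choice.copy vertex (can_type vertex_codeK).

Definition vertex_dist (R : realType) (p q : vertex) : R :=
  if p == q then 0 else
  match p, q with
  | pt_a, pt_u _ | pt_u _, pt_a => 1
  | pt_b, pt_v _ | pt_v _, pt_b => 1
  | pt_u i, pt_v j | pt_v i, pt_u j => if i == j then 1 else 2
  | _, _ => 2
  end.

Section VertexDist.
Variable R : realType.
Implicit Types p q r : vertex.

Lemma vertex_distxx p : vertex_dist R p p = 0.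
Proof. by rewrite /vertex_dist eqxx. Qed.

Lemma vertex_dist_bounds p q : p != q -> 1 <= vertex_dist R p q <= 2.
Proof.
rewrite /vertex_dist => /negPf ->.
by case: p q => [||i|i] [||j|j] //=; try case: ifP => _; apply/andP; split; lra.
Qed.

Lemma vertex_dist_eq0 p q : vertex_dist R p q = 0 -> p = q.
Proof.
by have [//|/vertex_dist_bounds/andP[h _] h0] := eqVneq p q; exfalso; lra.
Qed.

Lemma vertex_dist_sym p q : vertex_dist R p q = vertex_dist R q p.
Proof.
rewrite /vertex_dist eq_sym; case: ifP => // _.
by case: p q => [||i|i] [||j|j] //=; rewrite eq_sym.
Qed.

Lemma vertex_dist_triangle q p r :
  vertex_dist R p r <= vertex_dist R p q + vertex_dist R q r.
Proof.
have [->|/vertex_dist_bounds/andP[h1 h2]] := eqVneq p q.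
  by rewrite vertex_distxx add0r.
have [<-|/vertex_dist_bounds/andP[h3 h4]] := eqVneq q r.
  by rewrite vertex_distxx addr0.
have [E|/vertex_dist_bounds/andP[h5 h6]] := eqVneq p r; last lra.
by move: h1; rewrite E vertex_distxx; lra.
Qed.

End VertexDist.

(* A copy of [vertex] indexed by the field of scalars, so that the metric
   structure, which depends on [R], can be inferred from the type. *)
Definition vertex_space (R : realType) : Type := vertex.

HB.instance Definition _ (R : realType) := Choice.on (vertex_space R).

HB.instance Definition _ (R : realType) :=
  isMetric.Build R (vertex_space R) (@vertex_distxx R) (@vertex_dist_eq0 R)
    (@vertex_dist_sym R) (@vertex_dist_triangle R).

Lemma mdistE (R : realType) (p q : vertex_space R) :
  mdist p q = vertex_dist R p q.
Proof. by []. Qed.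

(* Main.v *)
Require Import Defs.
From mathcomp Require Import all_boot all_order all_algebra.
From mathcomp Require Import classical_sets cardinality reals topology.
From mathcomp Require Import boolp lra.

(** Every distance between distinct points is [1] or [2], and the points at
    distance [1] from [pt_u i] are [pt_a] and [pt_v i] only; exchanging [u]
    with [v] and [a] with [b] is an isometry.

    For the positive part, take [pt_u i] and [pt_v i], at distance [1], with an
    index [i] that [N] does not meet.  Seen from [N], at most the one point
    [pt_a] is at distance [1] from [pt_u i], so the perimeter
    [d(x,u_i) + d(y,u_i)] exceeds [d(x,y)] by at least [1]
    ([mdist_fresh_u], [mdist_fresh_v]).  Adding this to its mirror image
    yields the inequality even without the factor [1 - eps].

    The long trapezoid property fails already for [N = {a, b}].  As distances
    are integers, a small [eps] costs nothing, so a witness [(u, v)] would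
    satisfy the inequality exactly for [(x, y)] equal to [(a, b)] and to
    [(b, a)].  Since [d(a,p) + d(b,p) <= 3] for every [p], adding the two forces
    [d(u,v) = 1] and rules out [a] and [b]; so the pair is [(u_i, v_i)] in some
    order, but then [d(a,u_i) + d(b,v_i) = 2 < 3 = d(a,b) + d(u_i,v_i)]. *)

Import Order.TTheory GRing.Theory Num.Theory.
Local Open Scope classical_set_scope.
Local Open Scope ring_scope.

Lemma finite_set_fresh_index (N : set vertex) :
  finite_set N -> exists i, ~ N (pt_u i) /\ ~ N (pt_v i).
Proof.
move=> Nfin; apply: contrapT => /forallNP Nall.
apply: infinite_nat.
have -> : [set: nat] = pt_u @^-1` N `|` pt_v @^-1` N.
  apply/esym/seteqP; split=> // i _ /=.
  by apply: contrapT => /not_orP; exact: Nall.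
rewrite finite_setU; split; apply: finite_preimage => // i j _ _.
- by case.
- by case.
Qed.

(** Apart from [pt_u i] and [pt_v i], only [pt_a] is closer than [2] to
    [pt_u i].  So for distinct [x] and [y] the right-hand side is at least
    [1 + 2], while for [x = y] it is at least [2] and [mdist x y] vanishes. *)
Lemma mdist_fresh_u (R : realType) (N : set (vertex_space R)) (i : nat)
    (x y : vertex_space R) :
  ~ N (pt_u i) -> ~ N (pt_v i) -> N x -> N y ->
  mdist x y + 1 <= mdist x (pt_u i : vertex_space R)
                   + mdist y (pt_u i : vertex_space R).
Proof.
move=> Nu Nv Nx Ny; rewrite !mdistE.
have far p : N p -> p <> pt_a -> vertex_dist R p (pt_u i) = 2.
  rewrite /vertex_dist; case: eqP => [-> /Nu//|_].
  by case: p => [||j|j] //=; case: eqP => // ->.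
have near_a : vertex_dist R pt_a (pt_u i) = 1 by [].
have le2 : vertex_dist R x y <= 2.
  have [->|/(vertex_dist_bounds R)/andP[]//] := eqVneq x y.
  by rewrite vertex_distxx.
have [xa|/eqP xa] := eqVneq x pt_a; have [ya|/eqP ya] := eqVneq y pt_a.
- by rewrite xa ya vertex_distxx near_a; lra.
- by rewrite (far y) // xa near_a -xa; lra.
- by rewrite (far x) // ya near_a -ya; lra.
- by rewrite !far //; lra.
Qed.

(** Exchanges the two halves of the space, so that facts about [pt_v] follow
    from those about [pt_u]. *)
Definition vertex_swap (p : vertex) : vertex :=
  match p with
  | pt_a => pt_b
  | pt_b => pt_a
  | pt_u i => pt_v i
  | pt_v i => pt_u i
  end.

Lemma vertex_swapK : involutive vertex_swap.
Proof. by case. Qed.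

Lemma vertex_dist_swap (R : realType) (p q : vertex) :
  vertex_dist R (vertex_swap p) (vertex_swap q) = vertex_dist R p q.
Proof.
rewrite /vertex_dist (inj_eq (inv_inj vertex_swapK)); case: ifP => // _.
by case: p q => [||i|i] [||j|j].
Qed.

Lemma mdist_fresh_v (R : realType) (N : set (vertex_space R)) (i : nat)
    (x y : vertex_space R) :
  ~ N (pt_u i) -> ~ N (pt_v i) -> N x -> N y ->
  mdist x y + 1 <= mdist x (pt_v i : vertex_space R)
                   + mdist y (pt_v i : vertex_space R).
Proof.
move=> Nu Nv Nx Ny.
have := @mdist_fresh_u R (vertex_swap @^-1` N) i (vertex_swap x) (vertex_swap y).
rewrite !mdistE -[pt_u i]/(vertex_swap (pt_v i)) !vertex_dist_swap /=.
by rewrite !vertex_swapK; exact.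
Qed.

(** The value [1/8] is small enough: the left-hand side is at most [4] before
    scaling, so less than one unit is lost and integrality of the distances
    gives exact inequalities. *)
Lemma trapezoid_ab_fails (R : realType) (u v : vertex) :
  u <> v ->
  (1 - 8^-1) * (vertex_dist R pt_a pt_b + vertex_dist R u v)
    <= vertex_dist R pt_a u + vertex_dist R pt_b v ->
  (1 - 8^-1) * (vertex_dist R pt_b pt_a + vertex_dist R u v)
    <= vertex_dist R pt_b u + vertex_dist R pt_a v -> False.
Proof.
rewrite /vertex_dist => /eqP/negPf ->.
by case: u v => [||i|i] [||j|j] /=; try case: ifP => _; lra.
Qed.

Theorem mainTheorem3 (R : realType) :
  (forall (N : set (vertex_space R)) (eps : R), finite_set N -> 0 < eps ->
    exists u v : vertex_space R, u <> v /\
      forall x y z w : vertex_space R, N x -> N y -> N z -> N w ->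
        (1 - eps) * (2 * mdist u v + mdist x y + mdist z w)
          <= mdist x u + mdist y u + mdist z v + mdist w v)
  /\ ~ long_trapezoid_property (vertex_space R).
Proof.
split=> [N eps Nfin eps_gt0|LTP].
  have [i [Nu Nv]] := @finite_set_fresh_index N Nfin.
  exists (pt_u i), (pt_v i); split=> // x y z w Nx Ny Nz Nw.
  have uv1 : mdist (pt_u i : vertex_space R) (pt_v i : vertex_space R) = 1.
    by rewrite mdistE /vertex_dist /= eqxx.
  have xyu := @mdist_fresh_u R N i x y Nu Nv Nx Ny.
  have zwv := @mdist_fresh_v R N i z w Nu Nv Nz Nw.
  have xy_ge0 := mdist_ge0 x y; have zw_ge0 := mdist_ge0 z w.
  rewrite uv1.
  apply: (@le_trans _ _ (2 * 1 + mdist x y + mdist z w)); last by lra.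
  by apply: ler_piMl; lra.
have eps_gt0 : 0 < 8^-1 :> R by rewrite invr_gt0 ltr0n.
have [||u [v [uv uvP]]] :=
  LTP [set (pt_a : vertex_space R); (pt_b : vertex_space R)] 8^-1.
- exact: finite_set2.
- exact: eps_gt0.
apply: (@trapezoid_ab_fails R u v uv).
- by apply: (uvP pt_a pt_b); [left|right].
- by apply: (uvP pt_b pt_a); [right|left].
Qed.
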